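(* Let $G$ be a graph on $n$ vertices with $n$ odd. (i) If $G$ is a weakly $(n,\beta)$-graph with $0<\beta\le 1/3$, then $G$ is factor-critical. (ii) If $G$ is an $(n,\beta)$-graph with $0<\beta\le 1/2$, then $G$ is factor-critical.
   Context: All graphs are finite, simple and nonempty. A graph $G$ is factor-critical if $G-v$ has a perfect matching for every vertex $v$. For vertex sets $X,Y$, $e(X,Y)$ is the number of edges with one end in $X$ and the other in $Y$ (edges with both ends in $X\cap Y$ counted twice). For $\beta>0$, a graph on $n$ vertices is a weakly $(n,\beta)$-graph if $\frac{|X||Y|}{(n-|X|)(n-|Y|)}\le\beta^2$ for every pair of disjoint proper subsets $X,Y$ of $V(G)$ with no edge between them; it is an $(n,\beta)$-graph if this inequality holds for every pair of (not necessarily disjoint) proper subsets $X,Y$ with $e(X,Y)=0$. By convention $K_n$ is an $(n,\beta)$-graph for every $\beta>0$. *)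

(* Defs.v *)
From mathcomp Require Import all_boot all_order all_algebra.

Set Implicit Arguments.
Unset Strict Implicit.
Unset Printing Implicit Defensive.

Import Order.TTheory GRing.Theory Num.Theory.
Local Open Scope ring_scope.

Definition simple_graph (T : finType) (e : rel T) : Prop :=
  symmetric e /\ irreflexive e.

Definition complete_graph (T : finType) (e : rel T) : Prop :=
  forall x y : T, x != y -> e x y.

Definition edge_set (T : finType) (e : rel T) : {set {set T}} :=
  [set [set p.1; p.2] | p : T * T & e p.1 p.2].

Definition perfect_matching (T : finType) (e : rel T) (M : {set {set T}}) : Prop :=
  [/\ M \subset edge_set e, trivIset M & cover M = [set: T]].

Definition delete_vertex (T : finType) (e : rel T) (v : T) : rel {x : T | x != v} :=
  fun x y => e (val x) (val y).

Definition factor_critical (T : finType) (e : rel T) : Prop :=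
  forall v : T, exists M, perfect_matching (@delete_vertex T e v) M.

(* Counting ordered pairs counts an edge with both ends in X :&: Y twice. *)
Definition edges_between (T : finType) (e : rel T) (X Y : {set T}) : nat :=
  #|[set p : T * T | [&& p.1 \in X, p.2 \in Y & e p.1 p.2]]|.

Definition nbeta_ineq (R : realFieldType) (T : finType) (n : nat) (beta : R)
    (X Y : {set T}) : Prop :=
  (#|X|%:R * #|Y|%:R) / ((n%:R - #|X|%:R) * (n%:R - #|Y|%:R)) <= beta ^+ 2.

Definition weakly_nbeta_graph (R : realFieldType) (T : finType) (n : nat)
    (beta : R) (e : rel T) : Prop :=
  #|T| = n /\
  forall X Y : {set T}, X \proper [set: T] -> Y \proper [set: T] ->
    [disjoint X & Y] -> edges_between e X Y = 0%N -> nbeta_ineq n beta X Y.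

(* The inequality can fail for K_n (take X = Y a singleton and beta small), so
   the convention on complete graphs is a genuine extra case here; weakly
   (n, beta)-graphs need none, as it is automatic there. *)
Definition nbeta_graph (R : realFieldType) (T : finType) (n : nat)
    (beta : R) (e : rel T) : Prop :=
  #|T| = n /\
  (complete_graph e \/
   forall X Y : {set T}, X \proper [set: T] -> Y \proper [set: T] ->
     edges_between e X Y = 0%N -> nbeta_ineq n beta X Y).

(* Main.v *)
Require Import Defs.
From mathcomp Require Import all_boot all_order all_algebra.
From mathcomp Require Import zify.

(** By Tutte's theorem and parity, a graph of odd order that is not
    factor-critical has a nonempty vertex set S, of size s, whose deletion
    leaves at least s + 1 odd components.  Distribute the components over two
    sides, halving the odd ones.  In (i) the two sides X, Y satisfy 2|X| > s and
    2|Y| >= s, so |X| / (s + |X|) > 1/3 and |Y| / (s + |Y|) >= 1/3.  In (ii) the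
    isolated vertices of G - S are put into both X and Y and only the other odd
    components, which have at least three vertices, are halved: now
    2|X| > n - |Y| and 2|Y| >= n - |X|.  Both contradict the inequality defining
    (n, beta)-graphs.

    Tutte's theorem is proved from Hall's theorem by taking a barrier that is
    tight and of maximal size. *)

Set Implicit Arguments.
Unset Strict Implicit.
Unset Printing Implicit Defensive.

Import Order.TTheory GRing.Theory Num.Theory.

(** * Hall's marriage theorem *)

Theorem hall_marriage (I T : finType) (x0 : T) (N : I -> {set T})
    (P : {set I}) :
  (forall Q : {set I}, Q \subset P -> #|Q| <= #|\bigcup_(i in Q) N i|) ->
  exists2 f : I -> T, {in P &, injective f} & {in P, forall i, f i \in N i}.
Proof.
have [m] := ubnP #|P|; elim: m => // m IH in N P *; rewrite ltnS => leP hallP.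
have [->|[i0 Pi0]] := set_0Vmem P.
  (* [f] is a total function, so a default value is required even when nothing has to be matched. *)
  by exists (fun=> x0) => [i|i]; rewrite inE.
(* Halmos-Vaughan: either some proper subfamily is tight, and it can be matched
   separately from the rest, or any single choice for i0 leaves Hall's
   condition intact. *)
have [/existsP[Q /and3P[QP Q0 /eqP tight]]|slack] := boolP [exists Q : {set I},
    [&& Q \proper P, Q != set0 & #|Q| == #|\bigcup_(i in Q) N i|]].
  have [sQP ltQP] := (proper_sub QP, proper_card QP).
  have [f f_inj fN] := IH N Q (leq_trans ltQP leP)
    (fun Q' sQ' => hallP Q' (subset_trans sQ' sQP)).
  set W := \bigcup_(i in Q) N i in tight.
  have [||g g_inj gN] := IH (fun i => N i :\: W) (P :\: Q).
  - have := cardsID Q P; rewrite (setIidPr sQP).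
    by move: leP; rewrite -card_gt0 in Q0; lia.
  - move=> Q' sQ'.
    (* The values of the tight [Q] fill exactly [W], so Hall's condition for [Q :|: Q'] leaves
       Hall's condition for [Q'] outside [W]. *)
    have := hallP (Q :|: Q'); rewrite subUset sQP /=.
    move=> /(_ (subset_trans sQ' (subsetDl _ _))).
    have dQ : [disjoint Q & Q'].
      by rewrite disjoint_sym; move: sQ'; rewrite subsetD => /andP[].
    rewrite cardsU (disjoint_setI0 dQ) cards0 subn0 tight.
    have : #|\bigcup_(i in Q :|: Q') N i|
        <= #|W| + #|\bigcup_(i in Q') (N i :\: W)|.
      rewrite -leq_subLR.
      apply: leq_trans (_ : #|(\bigcup_(i in Q :|: Q') N i) :\: W| <= _).
        by rewrite cardsD leq_sub2l // subset_leq_card // subsetIr.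
      apply: subset_leq_card; apply/subsetP=> x /setDP[/bigcupP[i iQ xi] xW].
      case/setUP: iQ => iQ; first by case/bigcupP: xW; exists i.
      by apply/bigcupP; exists i => //; rewrite inE xW.
    by lia.
  have fW i : i \in Q -> f i \in W.
    by move=> iQ; apply/bigcupP; exists i => //; apply: fN.
  have gW i : i \in P -> i \notin Q -> (g i \notin W) && (g i \in N i).
    by move=> Pi iQ; have := gN i; rewrite !inE iQ; apply.
  exists (fun i => if i \in Q then f i else g i).
    move=> i j Pi Pj; case: ifPn => iQ; case: ifPn => jQ; first exact: f_inj.
    + by move=> fg; have := gW j Pj jQ; rewrite -fg fW.
    + by move=> fg; have := gW i Pi iQ; rewrite fg fW.
    + by apply: g_inj; rewrite inE ?iQ ?jQ.
  by move=> i Pi; case: ifPn => iQ; [exact: fN|case/andP: (gW i Pi iQ)].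
have /card_gt0P[x1 x1i] : 0 < #|N i0|.
  by have := hallP [set i0]; rewrite big_set1 cards1 sub1set; exact.
have [||g g_inj gN] := IH (fun i => N i :\ x1) (P :\ i0).
- by have := cardsD1 i0 P; rewrite Pi0; lia.
- move=> Q sQ; have [->|Q0] := eqVneq Q set0; first by rewrite cards0.
  have QP : Q \proper P by apply: sub_proper_trans (properD1 Pi0).
  have /existsPn/(_ Q) := slack; rewrite QP Q0 /= => neq.
  (* Without tightness the inequality is strict, which absorbs the loss of [x1]. *)
  have := hallP Q (proper_sub QP); rewrite leq_eqVlt (negPf neq) /= => lt.
  have -> : \bigcup_(i in Q) (N i :\ x1) = (\bigcup_(i in Q) N i) :\ x1.
    apply/setP=> x; rewrite !inE; apply/bigcupP/andP.
      by case=> i iQ /setD1P[-> xi]; split=> //; apply/bigcupP; exists i.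
    by case=> xx1 /bigcupP[i iQ xi]; exists i => //; rewrite !inE xx1.
  by have := cardsD1 x1 (\bigcup_(i in Q) N i); lia.
have gx1 i : i \in P -> i != i0 -> (g i != x1) && (g i \in N i).
  by move=> Pi ii0; have := gN i; rewrite !inE ii0; apply.
exists (fun i => if i == i0 then x1 else g i).
  move=> i j Pi Pj; case: eqP => [->|/eqP ii0]; case: eqP => [->|/eqP ji0] //.
  - by move=> gj; have := gx1 j Pj ji0; rewrite -gj eqxx.
  - by move=> gi; have := gx1 i Pi ii0; rewrite gi eqxx.
  - by apply: g_inj; rewrite !inE ?ii0 ?ji0.
by move=> i Pi; case: eqP => [->|/eqP ii0] //; case/andP: (gx1 i Pi ii0).
Qed.

(** * Matchings of vertex sets *)

(** Built edge by edge on vertex sets, so that unions need no bookkeeping of edge sets;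
    [perfect_matching_delete] recovers the edges at the end. *)
Inductive matchable (T : finType) (e : rel T) : {set T} -> Prop :=
| matchable0 : matchable e set0
| matchableU2 x y (A : {set T}) : e x y -> x != y -> x \notin A ->
    y \notin A -> matchable e A -> matchable e ([set x; y] :|: A).

Lemma matchableU (T : finType) (e : rel T) (A B : {set T}) :
  matchable e A -> matchable e B -> [disjoint A & B] -> matchable e (A :|: B).
Proof.
move=> mA mB; elim: A / mA => [|x y A exy xy xA yA mA IH] dAB.
  by rewrite set0U.
have dA : [disjoint A & B] by apply: disjointWl dAB; apply: subsetUr.
rewrite -setUA; apply: matchableU2 => //; last exact: IH.
  by rewrite !inE (negPf xA) (disjointFr dAB) // !inE eqxx.
by rewrite !inE (negPf yA) (disjointFr dAB) // !inE eqxx orbT.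
Qed.

Lemma matchable_bigcup (I T : finType) (e : rel T) (F : I -> {set T})
    (P : {set I}) :
  {in P, forall i, matchable e (F i)} ->
  {in P &, forall i j, i != j -> [disjoint F i & F j]} ->
  matchable e (\bigcup_(i in P) F i).
Proof.
have [m] := ubnP #|P|; elim: m => // m IH in P *; rewrite ltnS => leP mF dF.
have [->|[i Pi]] := set_0Vmem P; first by rewrite big_set0; apply: matchable0.
rewrite (big_setD1 i Pi); apply: matchableU; first exact: mF.
  apply: IH => [|j|j k]; first by move: leP; rewrite (cardsD1 i P) Pi.
    by move/setD1P=> [_]; apply: mF.
  by move=> /setD1P[_ Pj] /setD1P[_ Pk]; apply: dF.
by apply: bigcup_disjoint => j /setD1P[ji Pj]; apply: dF; rewrite // eq_sym.
Qed.

(** * Separated partitions and barriers *)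

Definition separated (T : finType) (e : rel T) (P : {set {set T}}) :=
  [forall A in P, forall B in P, (A != B) ==>
     [forall x in A, forall y in B, ~~ e x y]].

Lemma separatedP (T : finType) (e : rel T) (P : {set {set T}}) :
  reflect {in P &, forall A B : {set T}, A != B ->
             {in A & B, forall x y, ~~ e x y}}
    (separated e P).
Proof.
apply: (iffP idP) => [sepP A B PA PB AB x y Ax By|sepP].
  move/forall_inP/(_ A PA)/forall_inP/(_ B PB)/implyP/(_ AB): sepP.
  by move/forall_inP/(_ x Ax)/forall_inP/(_ y By).
apply/forall_inP=> A PA; apply/forall_inP=> B PB; apply/implyP=> AB.
by apply/forall_inP=> x Ax; apply/forall_inP=> y By; apply: (sepP A B).
Qed.

Definition odd_parts (T : finType) (P : {set {set T}}) : {set {set T}} :=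
  [set A in P | odd #|A|].

(* A separated partition of U :\: S replaces the family of connected components:
   its parts are unions of components, and an odd union contains an odd
   component, so Tutte's condition is unaffected. *)
Definition barrier (T : finType) (e : rel T) (U S : {set T})
    (P : {set {set T}}) :=
  [&& S \subset U, partition P (U :\: S) & separated e P].

Lemma odd_card_partition (T : finType) (P : {set {set T}}) (D : {set T}) :
  partition P D -> odd #|D| = odd #|odd_parts P|.
Proof.
move=> partP; rewrite (card_partition partP).
have -> : #|odd_parts P| = \sum_(A in P) odd #|A|.
  by rewrite -sum1_card big_mkcond [RHS]big_mkcond /=; apply: eq_bigr => A _;
     rewrite inE; case: (A \in P); case: (odd _).
by elim/big_rec2: _ => // A m k _ IH; rewrite !oddD IH oddb.
Qed.

(** For even [#|U|] this turns an excess of one odd part over [#|S|] into an excess of two. *)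
Lemma barrier_parity (T : finType) (e : rel T) (U S : {set T})
    (P : {set {set T}}) :
  barrier e U S P -> odd #|odd_parts P| = odd #|U| (+) odd #|S|.
Proof.
case/and3P=> SU partP _; rewrite -(odd_card_partition partP).
by rewrite cardsD (setIidPr SU) oddB // subset_leq_card.
Qed.

(** The parts of [P'] lie inside [C], so they inherit its separation from the other parts of [P]. *)
Lemma barrier_refine (T : finType) (e : rel T) (U S C S' : {set T})
    (P P' : {set {set T}}) :
  symmetric e -> barrier e U S P -> C \in P -> barrier e C S' P' ->
  barrier e U (S :|: S') (P' :|: P :\ C).
Proof.
move=> sym_e /and3P[SU partP /separatedP sepP] PC.
case/and3P=> SC partP' /separatedP sepP'.
have CUS : C \subset U :\: S := partitionS partP PC.
have sub' A : A \in P' -> A \subset C.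
  by move/(partitionS partP')/subset_trans; apply; apply: subsetDl.
have partD := partitionD1 partP PC.
apply/and3P; split.
- rewrite subUset SU; apply: subset_trans SC _.
  exact: subset_trans CUS (subsetDl _ _).
- have dC : [disjoint C :\: S' & (U :\: S) :\: C].
    rewrite -setI_eq0; apply/eqP/setP=> x.
    by rewrite !inE; case: (x \in C); rewrite ?andbF.
  apply/and3P; split.
  + rewrite /cover bigcup_setU -!/(cover _) (cover_partition partP').
    rewrite (cover_partition partD); apply/eqP/setP=> x; rewrite !inE.
    have /implyP := subsetP CUS x; have /implyP := subsetP SC x; rewrite !inE.
    by case: (x \in C); case: (x \in S'); case: (x \in S); case: (x \in U).
  + apply: trivIsetU; [exact: partition_trivIset partP'| |].
      exact: partition_trivIset partD.
    by rewrite (cover_partition partP') (cover_partition partD).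
  + by rewrite inE (partition0 partP') (partition0 partD).
- apply/separatedP=> A B.
  case/setUP=> [PA|/setD1P[AC PA]] /setUP[PB|/setD1P[BC PB]] AB x y.
  + exact: sepP'.
  + move=> /(subsetP (sub' _ PA)) Cx By.
    by apply: (sepP C B); rewrite // eq_sym.
  + by move=> Ax /(subsetP (sub' _ PB)) Cy; apply: (sepP A C).
  + exact: sepP.
Qed.

(** The term [odd #|C|] accounts for the removal of [C]. No part is counted twice: a common one
    would be nonempty, inside [C] and disjoint from [C]. *)
Lemma odd_parts_refine (T : finType) (e : rel T) (U S C S' : {set T})
    (P P' : {set {set T}}) :
  barrier e U S P -> C \in P -> barrier e C S' P' ->
  #|odd_parts (P' :|: P :\ C)| + odd #|C| = #|odd_parts P'| + #|odd_parts P|.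
Proof.
move=> /and3P[SU partP _] PC /and3P[SC partP' _].
have -> : odd_parts (P' :|: P :\ C) = odd_parts P' :|: odd_parts P :\ C.
  by apply/setP=> A; rewrite !inE; case: (odd _); rewrite ?andbT ?andbF.
have dP : [disjoint odd_parts P' & odd_parts P :\ C].
  rewrite -setI_eq0; apply/eqP/setP=> A; rewrite !inE; apply/negP.
  case/andP=> /andP[P'A _] /and3P[AC PA _].
  have dAC : [disjoint A & C].
    by move/trivIsetP: (partition_trivIset partP); apply.
  have /set0Pn[x Ax] := partition_neq0 partP PA.
  have := disjointFr dAC Ax.
  by have /subsetP/(_ x Ax)/setDP[->] := partitionS partP' P'A.
rewrite cardsU (disjoint_setI0 dP) cards0 subn0.
by rewrite (cardsD1 C (odd_parts P)) inE PC /= -addnA [_ + odd _]addnC.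
Qed.

(** * Tutte's theorem *)

(** Relative to a set [U], so that the induction stays within one vertex type, and boolean, so that
    its failure yields a violating [S] and [P]. *)
Definition tutte_condition (T : finType) (e : rel T) (U : {set T}) :=
  [forall S : {set T}, forall P : {set {set T}},
     barrier e U S P ==> (#|odd_parts P| <= #|S|)].

Lemma tutte_conditionP (T : finType) (e : rel T) (U : {set T}) :
  reflect (forall S P, barrier e U S P -> #|odd_parts P| <= #|S|)
    (tutte_condition e U).
Proof.
apply: (iffP idP) => [/forallP tU S P|tU].
  by move: (tU S) => /forallP/(_ P)/implyP.
by apply/forallP=> S; apply/forallP=> P; apply/implyP/tU.
Qed.

(** Removing only the neighbourhood [W] of [Q] in [S] already detaches the parts of [Q] from all
    else, so Tutte's condition at [W] bounds [#|Q|]. *)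
Lemma tutte_hall (T : finType) (e : rel T) (U S : {set T})
    (P Q : {set {set T}}) :
  symmetric e -> tutte_condition e U -> barrier e U S P -> odd_parts P = P ->
  Q \subset P ->
  #|Q| <= #|\bigcup_(C in Q) [set s in S | [exists c in C, e c s]]|.
Proof.
move=> sym_e /tutte_conditionP tU /and3P[SU partP /separatedP sepP] oddP sQP.
set W := \bigcup_(C in Q) _.
have WS : W \subset S.
  by apply/bigcupsP=> C _; apply/subsetP=> s; rewrite inE => /andP[].
have partQ : partition Q (cover Q).
  rewrite /partition eqxx (trivIsetS sQP (partition_trivIset partP)) /=.
  by apply/negP=> /(subsetP sQP); rewrite (partition0 partP).
have coverQ : cover Q \subset U :\: S.
  by rewrite -(cover_partition partP); apply/bigcupsP=> C QC;
     apply: (bigcup_sup C) => //; apply: (subsetP sQP).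
(* All other remaining vertices are lumped into a single part. *)
set B := (U :\: W) :\: cover Q.
have dB : [disjoint B & cover Q].
  rewrite -setI_eq0; apply/eqP/setP=> x; rewrite !inE.
  by case: (x \in cover Q); rewrite ?andbF.
have UW : U :\: W = B :|: cover Q.
  apply/setP=> x; rewrite !inE; have /implyP := subsetP coverQ x.
  have /implyP := subsetP WS x; rewrite !inE.
  by case: (x \in U); case: (x \in S); case: (x \in W); case: (x \in cover Q).
have sepB C c x : C \in Q -> c \in C -> x \in B -> ~~ e c x.
  move=> QC Cc /setDP[/setDP[Ux Wx] Qx]; apply/negP=> ecx.
  have PC := subsetP sQP C QC.
  have [Sx|Sx] := boolP (x \in S).
    case/bigcupP: Wx; exists C; rewrite // inE Sx /=.
    by apply/existsP; exists c; rewrite Cc.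
  have : x \in cover P by rewrite (cover_partition partP) inE Sx.
  case/bigcupP=> D PD Dx; apply/negP: ecx; apply: (sepP C D) => //.
  by apply/eqP=> CD; case/bigcupP: Qx; exists C; rewrite // CD.
have oddQ (P' : {set {set T}}) : Q \subset P' -> Q \subset odd_parts P'.
  move=> QP'; apply/subsetP=> C QC; rewrite inE (subsetP QP') //=.
  by move/subsetP/(_ C QC): sQP; rewrite -oddP inE => /andP[].
(* Parts must be nonempty, so [B] joins the partition only if it is. *)
have [B0|B0] := eqVneq B set0.
  apply: leq_trans (tU W Q _); first exact/subset_leq_card/oddQ.
  rewrite /barrier (subset_trans WS) //= UW B0 set0U partQ /=.
  by apply/separatedP=> C D QC QD; apply: sepP; apply: (subsetP sQP).
apply: leq_trans (tU W (B |: Q) _); first exact/subset_leq_card/oddQ/subsetUr.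
rewrite /barrier (subset_trans WS) //= UW partitionU1 //=.
apply/separatedP=> C D /setU1P[->|QC] /setU1P[->|QD] CD x y Cx Dy.
- by rewrite eqxx in CD.
- by rewrite sym_e (sepB D).
- exact: (sepB C).
- by apply: (sepP C D) => //; apply: (subsetP sQP).
Qed.

Theorem tutte (T : finType) (e : rel T) (U : {set T}) :
  symmetric e -> tutte_condition e U -> matchable e U.
Proof.
move=> sym_e.
have [m] := ubnP #|U|; elim: m => // m IH in U *; rewrite ltnS => leU tU.
have tUP := tutte_conditionP _ _ tU.
have [->|[x0 Ux0]] := set_0Vmem U; first exact: matchable0.
pose tight := [pred S : {set T} | [exists P : {set {set T}},
  barrier e U S P && (#|odd_parts P| == #|S|)]].
have tight0 : tight set0.
  have bar : barrier e U set0 [set U].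
    rewrite /barrier sub0set setD0 /partition cover1 eqxx trivIset1 inE /=.
    rewrite eq_sym; apply/andP; split; first by apply/set0Pn; exists x0.
    by apply/separatedP=> A B /set1P-> /set1P->; rewrite eqxx.
  apply/existsP; exists [set U]; rewrite bar /=.
  by have := tUP _ _ bar; rewrite cards0 leqn0.
(* In a maximal tight barrier every part is odd and every part minus a vertex
   is matchable: otherwise a barrier inside the part would enlarge S. *)
case: (arg_maxnP (fun S : {set T} => #|S|) tight0) => S.
case/existsP=> P /andP[bar /eqP cardP] maxS.
have /and3P[SU partP /separatedP sepP] := bar.
(* A nonempty [S'] makes [S :|: S'] larger than [S], hence not tight, so Tutte's inequality is
   strict there; subtracting the equality for [S] leaves a bound inside [C]. *)
have enlarge C S' P' : C \in P -> barrier e C S' P' -> 0 < #|S'| ->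
    #|odd_parts P'| < #|S'| + odd #|C|.
  move=> PC bar' S'0.
  have bar2 := barrier_refine sym_e bar PC bar'.
  have card2 := odd_parts_refine bar PC bar'.
  have dS : #|S :|: S'| = #|S| + #|S'|.
    rewrite cardsU [X in _ - X](_ : _ = 0) ?subn0 //.
    apply/eqP; rewrite cards_eq0; apply/eqP/setP=> x; rewrite !inE.
    apply/negP=> /andP[Sx S'x].
    have /and3P[/subsetP/(_ x S'x) Cx _ _] := bar'.
    by have /subsetP/(_ x Cx) := partitionS partP PC; rewrite inE Sx.
  have := tUP _ _ bar2; rewrite dS leq_eqVlt => /predU1P[eq2|lt2].
    have : tight (S :|: S').
      by apply/existsP; exists (P' :|: P :\ C); rewrite bar2 dS eq2 eqxx.
    by move/maxS; rewrite /= dS -[leqRHS]addn0 leq_add2l leqNgt S'0.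
  rewrite -(ltn_add2r #|S|) -cardP -card2 cardP addnAC ltn_add2r.
  by rewrite addnC.
have oddC C : C \in P -> odd #|C|.
  move=> PC; apply/negPn/negP=> evenC.
  have /set0Pn[c Cc] := partition_neq0 partP PC.
  have cardC := cardsD1 c C; rewrite Cc in cardC.
  (* For even [C], removing [c] leaves one odd part, where [enlarge] allows none. *)
  have barC : barrier e C [set c] [set C :\ c].
    rewrite /barrier sub1set Cc /partition cover1 eqxx trivIset1 inE /=.
    apply/andP; split.
      by rewrite eq_sym -card_gt0; move: evenC; rewrite cardC; case: #|_|.
    by apply/separatedP=> A B /set1P-> /set1P->; rewrite eqxx.
  have := enlarge _ _ _ PC barC; rewrite cards1 (negPf evenC) => /(_ isT).
  rewrite addn0 ltnS leqn0 cards_eq0 => /eqP/setP/(_ (C :\ c)).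
  by rewrite !inE eqxx /=; move: evenC; rewrite cardC /= => /negPn->.
have mC C c : C \in P -> c \in C -> matchable e (C :\ c).
  move=> PC Cc; have cardC := cardsD1 c C; rewrite Cc in cardC.
  have CU : #|C| <= #|U|.
    apply/subset_leq_card/(subset_trans (partitionS partP PC)).
    exact: subsetDl.
  apply: IH; first by apply: leq_trans (leq_trans CU leU); rewrite cardC.
  apply/tutte_conditionP=> S' P' bar'; rewrite leqNgt; apply/negP=> lt.
  (* As [C :\ c] is even, a violation there has excess at least two over [#|S'|], while [enlarge] at
     [c |: S'] allows at most one. *)
  have := barrier_parity bar'; have := oddC C PC.
  rewrite cardC /= => /negPf-> /= par.
  have /and3P[S'C part' sep'] := bar'.
  have cS' : c \notin S' by apply/negP=> /(subsetP S'C); rewrite !inE eqxx.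
  have barC : barrier e C (c |: S') P'.
    rewrite /barrier sep' -setDDl part' subUset sub1set Cc /= !andbT.
    exact: subset_trans S'C (subD1set _ _).
  have := enlarge _ _ _ PC barC; rewrite cardsU1 cS' oddC //= => /(_ isT).
  rewrite addn1 add1n ltnS leqNgt ltn_neqAle lt andbT => /negPn/eqP eq1.
  by move: par; rewrite -eq1 /=; case: (odd _).
have oddP : odd_parts P = P.
  by apply/setP=> C; rewrite inE andb_idr //; apply: oddC.
pose N (C : {set T}) := [set s in S | [exists c in C, e c s]].
have [Q sQP|f f_inj fN] := @hall_marriage _ _ x0 N P.
  exact: tutte_hall bar oddP sQP.
(* There are as many parts as vertices in [S], so the injection [f] leaves no vertex of [S]
   unmatched. *)
have fS : f @: P = S.
  apply/eqP; rewrite eqEcard card_in_imset // -cardP oddP leqnn andbT.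
  apply/subsetP=> _ /imsetP[C PC ->].
  by have := fN C PC; rewrite inE => /andP[].
have PS C x : C \in P -> x \in C -> x \notin S.
  by move=> /(partitionS partP)/subsetP sC /sC/setDP[].
have fPS C : C \in P -> f C \in S by move=> PC; rewrite -fS imset_f.
(* On each piece, an edge from [f C] to a neighbour [c] in [C] is completed by a matching of
   [C :\ c]. *)
have -> : U = \bigcup_(C in P) (f C |: C).
  apply/setP=> x; apply/idP/bigcupP=> [Ux|[C PC /setU1P[->|Cx]]].
  - have [Sx|Sx] := boolP (x \in S).
      by move: Sx; rewrite -fS => /imsetP[C PC ->]; exists C; rewrite ?setU11.
    have : x \in cover P by rewrite (cover_partition partP) inE Sx.
    by case/bigcupP=> C PC Cx; exists C; rewrite // setU1r.
  - exact/(subsetP SU)/fPS.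
  - by have /subsetP/(_ x Cx)/setDP[] := partitionS partP PC.
apply: matchable_bigcup => [C PC|C D PC PD CD].
  have := fN C PC; rewrite inE => /andP[fCS /existsP[c /andP[Cc ecf]]].
  have fC : f C \notin C by apply: contraL fCS; apply: PS.
  have -> : f C |: C = [set c; f C] :|: C :\ c.
    by rewrite setUAC setD1K // setUC.
  apply: matchableU2 => //; first by apply: contraNneq fC => <-.
  - by rewrite !inE eqxx.
  - by rewrite !inE (negPf fC) andbF.
  - exact: mC.
have /trivIsetP/(_ C D PC PD CD) dCD := partition_trivIset partP.
have fCD A B : A \in P -> B \in P -> f A \notin B.
  by move=> PA PB; apply: contraL (fPS A PA); apply: PS.
rewrite -setI_eq0; apply/eqP/setP=> x; rewrite !inE; apply/negP.
case/andP=> /orP[/eqP->|Cx] /orP[/eqP|].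
- by move/f_inj => /(_ PC PD) CD'; rewrite CD' eqxx in CD.
- by move=> fD; have := fCD C D PC PD; rewrite fD.
- by move=> xfD; have := fCD D C PD PC; rewrite -xfD Cx.
- by rewrite (disjointFr dCD Cx).
Qed.

(** * Obstructions to factor-criticality *)

Lemma perfect_matching_delete (T : finType) (e : rel T) (v : T)
    (U : {set T}) :
  matchable e U -> v \notin U ->
  exists M : {set {set {x : T | x != v}}},
    [/\ M \subset edge_set (@delete_vertex T e v), trivIset M
      & cover M = [set x | val x \in U]].
Proof.
elim: U / => [|x y A exy xy xA yA _ IH] vA.
  exists set0; rewrite sub0set /cover big_set0; split=> //.
    by apply/trivIsetP=> ?; rewrite inE.
  by apply/setP=> x; rewrite !inE.
move: vA; rewrite !inE !negb_or => /andP[/andP[vx vy] vA].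
have [M [sM tM cM]] := IH vA.
rewrite eq_sym in vx; rewrite eq_sym in vy.
pose x' : {x : T | x != v} := Sub x vx; pose y' : {x : T | x != v} := Sub y vy.
exists ([set x'; y'] |: M); split.
- rewrite subUset sub1set sM andbT.
  by apply/imsetP; exists (x', y'); rewrite ?inE.
- apply: trivIsetU => //; first exact: trivIset1.
  rewrite cover1 cM -setI_eq0; apply/eqP/setP=> z; rewrite !inE.
  by apply/negP=> /andP[/orP[]/eqP->] /=; apply/negP.
- rewrite /cover bigcup_setU big_set1 -/(cover M) cM.
  by apply/setP=> z; rewrite !inE -!val_eqE.
Qed.

(** Otherwise Tutte's condition fails after deleting some [v], with excess at least two since the
    remaining order is even. The violation thus survives adding [v] to [S], which also makes [S]
    nonempty. *)
Lemma barrier_of_not_factor_critical (T : finType) (e : rel T) :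
  symmetric e -> odd #|T| ->
  factor_critical e \/
  exists (S : {set T}) P, [/\ 0 < #|S|, partition P (~: S), separated e P
                            & #|S| < #|odd_parts P|].
Proof.
move=> sym_e oddT.
have [/forallP tU|] := boolP [forall v, tutte_condition e (~: [set v])].
  left=> v; have vU : v \notin ~: [set v] by rewrite !inE eqxx.
  have [M [sM tM cM]] := perfect_matching_delete (tutte sym_e (tU v)) vU.
  exists M; split=> //; rewrite cM; apply/setP=> x.
  by rewrite !inE (valP x).
case/forallPn=> v; case/forallPn=> S; case/forallPn=> P.
rewrite negb_imply -ltnNge => /andP[bar lt]; right.
have par := barrier_parity bar; case/and3P: bar => SU partP sepP.
have vS : v \notin S by apply/negP=> /(subsetP SU); rewrite !inE eqxx.
exists (v |: S), P; split=> //; first by rewrite cardsU1 vS.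
  by rewrite setCU -setDE.
rewrite cardsU1 vS add1n ltn_neqAle lt andbT; apply/eqP=> eq1.
move: par; rewrite -eq1 /=; have := cardsC1 v.
by case: #|T| oddT => //= k /negPf oddk ->; rewrite oddk; case: (odd _).
Qed.

(** * Splitting the parts, and the numerical contradiction *)

(** [Q] is half of [L], rounded down; the summand [m] pays for the rounding. Case (i) takes [m] to
    be 1, case (ii) takes 3. *)
Lemma split_parts (T : finType) (P L : {set {set T}}) (m : nat) :
  trivIset P -> L \subset P -> {in L, forall A : {set T}, m <= #|A|} ->
  exists2 Q : {set {set T}}, Q \subset L &
    m * #|L| <= 2 * #|cover Q| + m /\ m * #|L| <= 2 * #|cover (P :\: Q)|.
Proof.
move=> tP sLP Lm.
have large (Q K : {set {set T}}) : K \subset P -> Q \subset K -> Q \subset L ->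
    m * #|Q| <= #|cover K|.
  move=> sKP sQK sQL; have /eqP<- := trivIsetS sKP tP.
  rewrite (big_setID Q) /= (setIidPr sQK); apply: leq_trans (leq_addr _ _).
  by rewrite mulnC -sum_nat_const; apply: leq_sum => A /(subsetP sQL)/Lm.
have /card_geqP[s [us ss sL]] : #|L|./2 <= #|L| by rewrite -divn2 leq_div.
pose Q := [set A in s].
have QL : Q \subset L by apply/subsetP=> A; rewrite inE => /sL.
have cQ : #|Q| = #|L|./2 by rewrite cardsE (card_uniqP us) ss.
exists Q => //.
have := large Q Q (subset_trans QL sLP) (subxx _) QL.
have := large (L :\: Q) (P :\: Q) (subsetDl _ _) (setSD _ sLP) (subsetDl _ _).
rewrite cardsD (setIidPr QL) cQ.
have := odd_double_half #|L|; case: (odd _); nia.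
Qed.

(** The last two hypotheses bound [n - #|Y|] strictly by [k * #|X|] and [n - #|X|] by [k * #|Y|];
    multiplying them makes the quotient exceed [1 / k ^ 2]. *)
Lemma nbeta_ineq_contra (R : realFieldType) (T : finType) (n k : nat)
    (beta : R) (X Y : {set T}) :
  0 < k -> (0 < beta)%R -> (beta <= 1 / k%:R)%R ->
  #|X| < n -> #|Y| < n -> n < k * #|X| + #|Y| -> n <= k * #|Y| + #|X| ->
  ~ nbeta_ineq n beta X Y.
Proof.
move=> k0 b0 bk Xn Yn nX nY; rewrite /nbeta_ineq -!natrB 1?ltnW //.
set x := #|X| in Xn nX nY *; set y := #|Y| in Yn nX nY *.
have b2 : (beta ^+ 2 <= (k ^ 2)%:R^-1)%R.
  rewrite natrX -exprVn -div1r; apply: lerXn2r => //; rewrite nnegrE ltW //.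
  by rewrite divr_gt0 ?ltr01 ?ltr0n.
move/le_trans/(_ b2); rewrite -!natrM ler_pdivrMr; last first.
  by rewrite ltr0n muln_gt0 !subn_gt0 Xn.
rewrite mulrC ler_pdivlMr ?ltr0n ?expn_gt0 ?k0 // -natrM ler_nat leqNgt.
case/negP; rewrite -mulnn mulnACA [x * k]mulnC [y * k]mulnC [ltnRHS]mulnC.
have X1 : n - x <= k * y by rewrite leq_subLR addnC.
apply: leq_ltn_trans (leq_mul X1 (leqnn _)) _.
have Y1 : n - y < k * x by rewrite ltn_subLR 1?addnC // ltnW.
by rewrite ltn_pmul2l // (leq_trans _ X1) // subn_gt0.
Qed.

(** Separation excludes edges between different parts, and a common part is a single vertex without
    a loop. This lets the two sides overlap in (ii). *)
Lemma edges_between_cover0 (T : finType) (e : rel T) (P Q K : {set {set T}}) :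
  irreflexive e -> separated e P -> Q \subset P -> K \subset P ->
  {in Q :&: K, forall A : {set T}, #|A| = 1} ->
  edges_between e (cover Q) (cover K) = 0.
Proof.
move=> irr_e /separatedP sepP sQ sK one; apply/eqP; rewrite cards_eq0.
apply/eqP/setP=> -[x y]; rewrite !inE /=; apply/negP.
case/and3P=> /bigcupP[A QA Ax] /bigcupP[B KB By] exy.
have [AB|AB] := eqVneq A B.
  have /eqP/cards1P[z Az] : #|A| = 1 by apply: one; rewrite inE QA AB.
  by move: Ax By exy; rewrite -AB Az => /set1P-> /set1P->; rewrite irr_e.
have [PA PB] := (subsetP sQ A QA, subsetP sK B KB).
by have := sepP A B PA PB AB x y Ax By; rewrite exy.
Qed.

Lemma disjoint_cover (T : finType) (P Q K : {set {set T}}) :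
  trivIset P -> Q \subset P -> K \subset P -> [disjoint Q & K] ->
  [disjoint cover Q & cover K].
Proof.
move=> /trivIsetP tP sQ sK dQK; rewrite -setI_eq0; apply/eqP/setP=> x.
rewrite in_set0; apply/negP=> /setIP[/bigcupP[A QA Ax] /bigcupP[B KB Bx]].
have AB : A != B by apply: contraTneq KB => <-; rewrite (disjointFr dQK).
have dAB := tP A B (subsetP sQ A QA) (subsetP sK B KB) AB.
by rewrite (disjointFr dAB Ax) in Bx.
Qed.

Lemma card_coverU (T : finType) (P Q K : {set {set T}}) :
  trivIset P -> Q \subset P -> K \subset P -> [disjoint Q & K] ->
  #|cover (Q :|: K)| = #|cover Q| + #|cover K|.
Proof.
move=> tP sQ sK dQK; rewrite /cover bigcup_setU -!/(cover _) cardsU.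
by rewrite (disjoint_setI0 (disjoint_cover tP sQ sK dQK)) cards0 subn0.
Qed.

(** * The two cases of the theorem *)

Theorem weakly_nbeta_factor_critical (R : realFieldType) (T : finType)
    (e : rel T) (n : nat) (beta : R) :
  simple_graph e -> odd n -> (0 < beta)%R -> (beta <= 1 / 3%:R)%R ->
  weakly_nbeta_graph n beta e -> factor_critical e.
Proof.
case=> sym_e irr_e oddn b0 b3 [Tn nb]; rewrite -Tn in oddn.
have [//|[S [P [S0 partP sepP ltSP]]]] :=
  barrier_of_not_factor_critical sym_e oddn.
exfalso; have tP := partition_trivIset partP.
have oddP : odd_parts P \subset P by apply/subsetP=> A; rewrite inE => /andP[].
have [A|Q sQ [lQ lPQ]] := @split_parts _ P (odd_parts P) 1 tP oddP.
  by rewrite inE => /andP[_]; case: #|A|.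
have sQP := subset_trans sQ oddP.
have dPQ : [disjoint P :\: Q & Q].
  rewrite -setI_eq0; apply/eqP/setP=> A; rewrite !inE.
  by case: (A \in Q); rewrite ?andbF.
have PDQ : P = P :\: Q :|: Q by rewrite setUC -{1}(setIidPr sQP) setID.
have cardPQ : #|cover P| = #|cover (P :\: Q)| + #|cover Q|.
  by rewrite {1}PDQ (card_coverU tP) // subsetDl.
have cardS := cardsC S; rewrite -(cover_partition partP) Tn cardPQ in cardS.
(* Nonemptiness of [S] keeps both sides proper. *)
have ltX : #|cover (P :\: Q)| < n by rewrite -cardS; move: S0; lia.
have ltY : #|cover Q| < n by rewrite -cardS; move: S0; lia.
apply: (@nbeta_ineq_contra R T n 3 beta (cover (P :\: Q)) (cover Q)) => //.
(* The goal amounts to [#|S| < 2 * #|cover (P :\: Q)|]: the strict bound goes to the side with the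
   larger half. *)
- by move: lPQ ltSP; rewrite -cardS; lia.
- by move: lQ ltSP; rewrite -cardS; lia.
apply: nb.
- by rewrite properEcard subsetT cardsT Tn.
- by rewrite properEcard subsetT cardsT Tn.
- by rewrite (disjoint_cover tP) // subsetDl.
- apply: (edges_between_cover0 irr_e sepP) => // [|A]; first exact: subsetDl.
  by rewrite (disjoint_setI0 dPQ) inE.
Qed.

Theorem nbeta_factor_critical (R : realFieldType) (T : finType)
    (e : rel T) (n : nat) (beta : R) :
  simple_graph e -> odd n -> (0 < beta)%R -> (beta <= 1 / 2%:R)%R ->
  nbeta_graph n beta e -> factor_critical e.
Proof.
case=> sym_e irr_e oddn b0 b2 [Tn nb]; rewrite -Tn in oddn.
have [//|[S [P [S0 partP sepP ltSP]]]] :=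
  barrier_of_not_factor_critical sym_e oddn.
exfalso; have tP := partition_trivIset partP.
have oddP : odd_parts P \subset P by apply/subsetP=> A; rewrite inE => /andP[].
case: nb => [complete_e|nb].
  (* Two distinct odd parts have no edge between them, which is impossible in a complete graph. *)
  have /card_gt1P[A [B [oA oB AB]]] : 1 < #|odd_parts P|.
    exact: leq_ltn_trans S0 ltSP.
  have [PA PB] := (subsetP oddP A oA, subsetP oddP B oB).
  have /set0Pn[x Ax] := partition_neq0 partP PA.
  have /set0Pn[y By] := partition_neq0 partP PB.
  have xy : x != y.
    apply: contraTneq By => <-.
    by have /trivIsetP/(_ A B PA PB AB)/disjointFr-> := tP.
  by have /separatedP/(_ A B PA PB AB x y Ax By) := sepP; rewrite complete_e.
(* These parts go to both sides; an odd part outside [J] has at least three vertices. *)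
pose J := [set A in P | #|A| == 1].
have sJ : J \subset P by apply/subsetP=> A; rewrite inE => /andP[].
have cJ : #|cover J| = #|J|.
  rewrite -(eqP (trivIsetS sJ tP)) -sum1_card; apply: eq_bigr => A.
  by rewrite inE => /andP[_ /eqP].
have sJodd : J \subset odd_parts P.
  by apply/subsetP=> A; rewrite !inE => /andP[-> /eqP->].
have cL : #|odd_parts P| = #|J| + #|odd_parts P :\: J|.
  by rewrite cardsD (setIidPr sJodd) subnKC // subset_leq_card.
have [||Q sQ [lQ lPQ]] :=
  @split_parts _ (P :\: J) (odd_parts P :\: J) 3 (trivIsetD _ tP).
- exact: setSD.
- move=> A; rewrite !inE; case: (A \in P) => //=.
  by case: #|A| => [|[|[|?]]].
set K := (P :\: J) :\: Q in lPQ.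
have sQP := subset_trans (subset_trans sQ (subsetDl _ _)) oddP.
have sKP : K \subset P := subset_trans (subsetDl _ _) (subsetDl _ _).
have dJQ : [disjoint J & Q].
  by rewrite disjoint_sym; move: sQ; rewrite subsetD => /andP[].
have dJK : [disjoint J & K].
  rewrite -setI_eq0; apply/eqP/setP=> A; rewrite in_set0 in_setI !in_setD.
  by case: (A \in J); rewrite ?andbF.
have dQK : [disjoint Q & K].
  rewrite -setI_eq0; apply/eqP/setP=> A; rewrite in_set0 in_setI !in_setD.
  by case: (A \in Q).
have cX := card_coverU tP sJ sKP dJK.
have cY := card_coverU tP sJ sQP dJQ.
have PJQK : P = (J :|: Q) :|: K.
  apply/setP=> A; rewrite /K !in_setU !in_setD.
  have := subsetP sJ A; have := subsetP sQP A.
  by case: (A \in J); case: (A \in Q); case: (A \in P) => // a b;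
     rewrite ?(a isT) ?(b isT).
have sJQ : J :|: Q \subset P by rewrite subUset sJ sQP.
have dJQK : [disjoint J :|: Q & K].
  by rewrite -setI_eq0 setIUl (disjoint_setI0 dJK) (disjoint_setI0 dQK) setU0.
have cP : #|cover P| = #|J| + #|cover Q| + #|cover K|.
  by rewrite {1}PJQK (card_coverU tP) // cY cJ.
have cardS := cardsC S; rewrite -(cover_partition partP) Tn cP in cardS.
rewrite cJ in cX cY.
have ltX : #|cover (J :|: K)| < n by rewrite cX -cardS; move: S0; clear; lia.
have ltY : #|cover (J :|: Q)| < n by rewrite cY -cardS; move: S0; clear; lia.
apply: (@nbeta_ineq_contra R T n 2 beta (cover (J :|: K)) (cover (J :|: Q)))
  => //.
(* The goal amounts to [#|S| < 2 * #|J| + #|cover K|]; with [l] odd parts outside [J], it follows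
   from [#|S| < #|J| + l] and [3 * l <= 2 * #|cover K|]. *)
- by rewrite cX cY -cardS; move: lPQ ltSP; rewrite cL; clear; lia.
- by rewrite cX cY -cardS; move: lQ ltSP; rewrite cL; clear; lia.
apply: nb.
- by rewrite properEcard subsetT cardsT Tn.
- by rewrite properEcard subsetT cardsT Tn.
- apply: (edges_between_cover0 irr_e sepP) => // [|A].
    by rewrite subUset sJ sKP.
  rewrite -setUIr setIC (disjoint_setI0 dQK).
  by rewrite setU0 inE => /andP[_ /eqP].
Qed.

Local Open Scope ring_scope.

Theorem theorem3p7 (R : realFieldType) (T : finType) (e : rel T) (n : nat)
    (he : simple_graph e) (hn : #|T| = n) (n_odd : odd n) :
  (forall beta : R, 0 < beta -> beta <= 1 / 3%:R ->
     weakly_nbeta_graph n beta e -> factor_critical e) /\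
  (forall beta : R, 0 < beta -> beta <= 1 / 2%:R ->
     nbeta_graph n beta e -> factor_critical e).
Proof.
split=> beta b0 bk; first exact: weakly_nbeta_factor_critical b0 bk.
exact: nbeta_factor_critical b0 bk.
Qed.
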